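(* Let $n\ge 1$. Regard $W(n)$ as a $W(1)$-module via $x\cdot D=[\Theta_W(x),D]$, where $\Theta_W(x_1^i\partial_1)=x_1^i\partial_1$. Then as $W(1)$-modules $$W(n)\cong V(p-1)^{\oplus(n-1)p^{n-1}}\oplus L(p-2)^{\oplus p^{n-1}},$$ and hence $$[W(n)]=(n-1)p^{n-1}\big([L(0)]+[L(p-1)]\big)+p^{n-1}[L(p-2)].$$
   Context: $\mathbb F$ is an algebraically closed field of characteristic $p>2$, $I=\{0,\dots,p-1\}$. $\mathcal A(n)$ is the truncated polynomial algebra with basis $x^\alpha$, $\alpha\in I^n$, $x^\alpha x^\beta=x^{\alpha+\beta}$ ($=0$ if $\alpha+\beta\notin I^n$). $W(n)$ is the derivation algebra of $\mathcal A(n)$, a free $\mathcal A(n)$-module on $\partial_1,\dots,\partial_n$ with $\partial_i(x_j)=\delta_{ij}$; $W(1)$ is the Witt algebra with basis $x_1^i\partial_1$, $i\in I$, a restricted Lie algebra (p-map: $p$-th power). $W(1)$ is graded by $W(1)_{[i]}=\mathbb F x_1^{i+1}\partial_1$, $-1\le i\le p-2$; set $W(1)_0=\bigoplus_{i\ge 0}W(1)_{[i]}$, $W(1)_1=\bigoplus_{i\ge1}W(1)_{[i]}$. For $\lambda\in I$, $\mathbb F_\lambda$ is the one-dimensional $W(1)_0$-module on which $x_1\partial_1$ acts by $\lambda$ and $W(1)_1$ acts by $0$; the restricted baby Verma module is $V(\lambda)=u(W(1))\otimes_{u(W(1)_0)}\mathbb F_\lambda$, where $u(\cdot)$ is the restricted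 enveloping algebra, and $L(\lambda)$ is its unique simple quotient. For a module $M$, $[M]$ denotes the formal sum of its composition factors (with multiplicity). *)

(* Defs.v *)
From HB Require Import structures.
From mathcomp Require Import all_boot all_algebra.
Set Implicit Arguments. Unset Strict Implicit. Unset Printing Implicit Defensive.
Import GRing.Theory.
Local Open Scope ring_scope.

(* exponents alpha in I^n, I = {0,..,p-1} *)
Notation mono p n := {ffun 'I_n -> 'I_p}.
(* A(n): coefficient functions alpha |-> coefficient of x^alpha *)
Notation An F p n := {ffun mono p n -> F^o}.
(* W(n): free A(n)-module on d_1..d_n, D = sum_j D_j d_j *)
Notation Wn F p n := {ffun 'I_n -> An F p n}.

(* product x^a x^b = x^(a+b), 0 if a+b not in I^n *)
Definition amul (F : fieldType) p n (f g : An F p n) : An F p n :=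
  [ffun c : mono p n => \sum_(a : mono p n)
     \sum_(b : mono p n | [forall i, (val (a i) + val (b i) == val (c i))%N])
       f a * g b].

Definition apart (F : fieldType) p n (i : 'I_n) (f : An F p n) : An F p n :=
  [ffun a : mono p n =>
     \sum_(b : mono p n | [forall j, (val (b j) == val (a j) + (j == i))%N])
       (val (b i))%:R * f b].

Definition xvar (F : fieldType) p n (j : 'I_n) : An F p n :=
  [ffun a : mono p n => if [forall k, (val (a k) == (k == j))%N] then 1 else 0].

Definition dact (F : fieldType) p n (D : Wn F p n) (f : An F p n) : An F p n :=
  \sum_(j < n) amul (D j) (apart j f).

(* Lie bracket of derivations: [D,E](x_j) = D(E_j) - E(D_j) *)
Definition wbr (F : fieldType) p n (D E : Wn F p n) : Wn F p n :=
  [ffun j => dact D (E j) - dact E (D j)].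

(* p-map: D^[p] is the derivation D^p (p-th iterate) *)
Definition wpow (F : fieldType) p n (D : Wn F p n) : Wn F p n :=
  [ffun j => iter p (dact D) (xvar F p j)].

Definition wbasis (F : fieldType) p (a : nat) : Wn F p 1 :=
  [ffun _ => [ffun al : mono p 1 => if (val (al ord0) == a)%N then 1 else 0]].

Definition theta (F : fieldType) p n (x : Wn F p 1) : Wn F p n :=
  [ffun j : 'I_n => if (val j == 0)%N then
     [ffun a : mono p n =>
        if [forall k : 'I_n, (val k != 0%N) ==> (val (a k) == 0%N)]
        then x ord0 [ffun _ : 'I_1 => a j] else 0]
   else 0].

Definition wnact (F : fieldType) p n (x : Wn F p 1) (D : Wn F p n) : Wn F p n :=
  wbr (theta n x) D.

Definition is_w1mod (F : fieldType) p (V : vectType F) (act : Wn F p 1 -> V -> V) : Prop :=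
  [/\ forall (a : F) x y v, act (a *: x + y) v = a *: act x v + act y v,
      forall x (a : F) u v, act x (a *: u + v) = a *: act x u + act x v &
      forall x y v, act (wbr x y) v = act x (act y v) - act y (act x v)].

(* module for the restricted enveloping algebra u(W(1)) *)
Definition restricted (F : fieldType) p (V : vectType F) (act : Wn F p 1 -> V -> V) : Prop :=
  forall x v, iter p (act x) v = act (wpow x) v.

(* v spans a copy of F_lam as W(1)_0-module *)
Definition hw (F : fieldType) p (V : vectType F) (act : Wn F p 1 -> V -> V)
  (lam : nat) (v : V) : Prop :=
  act (wbasis F p 1) v = lam%:R *: v /\
  forall a, (2 <= a < p)%N -> act (wbasis F p a) v = 0.

Definition intertw (F : fieldType) p (V N : vectType F)
  (actV : Wn F p 1 -> V -> V) (actN : Wn F p 1 -> N -> N) (f : 'Hom(V, N)) : Prop :=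
  forall x u, f (actV x u) = actN x (f u).

(* (V, act) is (isomorphic to) the restricted baby Verma module
   V(lam) = u(W(1)) (x)_{u(W(1)_0)} F_lam, characterized by the universal
   property of induction (Frobenius reciprocity). *)
Definition is_verma (F : fieldType) p (lam : nat) (V : vectType F)
  (act : Wn F p 1 -> V -> V) : Prop :=
  [/\ is_w1mod act, restricted act &
      exists v : V, hw act lam v /\
        forall (N : vectType F) (actN : Wn F p 1 -> N -> N),
          is_w1mod actN -> restricted actN ->
          forall w : N, hw actN lam w ->
            exists! f : 'Hom(V, N), intertw act actN f /\ f v = w].

Definition is_simple (F : fieldType) p (V : vectType F) (act : Wn F p 1 -> V -> V) : Prop :=
  (0 < \dim (fullv : {vspace V}))%N /\
  forall U : {vspace V}, (forall x u, u \in U -> act x u \in U) ->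
    U = 0%VS \/ U = fullv.

Definition is_L (F : fieldType) p (lam : nat) (V : vectType F)
  (act : Wn F p 1 -> V -> V) : Prop :=
  [/\ is_w1mod act, is_simple act &
      exists (M : vectType F) (actM : Wn F p 1 -> M -> M),
        is_verma lam actM /\
        exists f : 'Hom(M, V), intertw actM act f /\ limg f = fullv].

Definition stable (F : fieldType) p n (U : {vspace Wn F p n}) : Prop :=
  forall x u, u \in U -> @wnact F p n x u \in U.

Definition sub_iso_verma (F : fieldType) p n (lam : nat) (U : {vspace Wn F p n}) : Prop :=
  exists (M : vectType F) (actM : Wn F p 1 -> M -> M),
    is_verma lam actM /\
    exists f : 'Hom(M, Wn F p n), intertw actM (@wnact F p n) f /\
      lker f = 0%VS /\ limg f = U.

Definition sub_iso_L (F : fieldType) p n (lam : nat) (U : {vspace Wn F p n}) : Prop :=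
  exists (M : vectType F) (actM : Wn F p 1 -> M -> M),
    is_L lam actM /\
    exists f : 'Hom(M, Wn F p n), intertw actM (@wnact F p n) f /\
      lker f = 0%VS /\ limg f = U.

(* for submodules U <= V of W(n): V/U is isomorphic to L(lam) *)
Definition factor_L (F : fieldType) p n (lam : nat) (U V : {vspace Wn F p n}) : Prop :=
  exists (N : vectType F) (actN : Wn F p 1 -> N -> N),
    is_L lam actN /\
    exists f : 'Hom(Wn F p n, N),
      (forall x u, u \in V -> f (@wnact F p n x u) = actN x (f u)) /\
      (f @: V)%VS = fullv /\ (lker f :&: V)%VS = U.

(* Main.v *)
Require Import Defs.
From HB Require Import structures.
From mathcomp Require Import all_boot all_algebra ring.
Set Implicit Arguments. Unset Strict Implicit. Unset Printing Implicit Defensive.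
Import GRing.Theory.
Local Open Scope ring_scope.

(** Truncation identifies [A(1)] with [F[X]/(X^p)], and the densities of weight [c], i.e. [A(1)]
    with [g d/dX] acting by [h |-> g h' + c g' h], form a restricted [W(1)]-module when [c] lies
    in the prime field.  The vector [X^(p-1)] is killed by [W(1)_1], has weight [c - 1] and
    generates the module under [d/dX], so this module is [V(c - 1)].  Taking coefficients with
    respect to the monomials in [x_2, .., x_n] splits [W(n)] into copies of the densities of
    weight [0] (in front of [d_j], [j > 1]) and of weight [-1] (in front of [d_1]).  The former
    are [V(p-1)], with the constants [L(0)] as a submodule and quotient [L(p-1)], which [d/dX]
    identifies with the exact forms in the densities of weight [1]; the latter are simple. *)

(** * Leibniz rules for iterates *)

(** Pascal's rule, as in the classical case. Three maps are allowed because the Lie derivative of a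
    product of densities acts on each factor through the weight of that factor. *)
Lemma iter_twisted_Leibniz (R : nzRingType) (D D1 D2 : {additive R -> R}) :
  (forall u v, D (u * v) = D1 u * v + u * D2 v) ->
  forall n u v, iter n D (u * v) =
    \sum_(i < n.+1) (iter (n - i) D1 u * iter i D2 v) *+ 'C(n, i).
Proof.
move=> DM; elim=> [|n IHn] u v; first by rewrite big_ord1 bin0 mulr1n.
rewrite iterS IHn raddf_sum /=.
under eq_bigr => i _ do rewrite raddfMn /= DM mulrnDl -!iterS -subSn ?leq_ord //.
rewrite big_split /= [RHS]big_ord_recl /= [X in X + _ = _]big_ord_recl /= !bin0 -addrA.
congr (_ + _); under [RHS]eq_bigr => i _ do rewrite /bump /= add1n binS mulrnDr.
rewrite big_split /= [X in _ = X + _]big_ord_recr /= bin_small // mulr0n addr0.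
by congr (_ + _); apply: eq_bigr => i _; rewrite /bump /= add1n.
Qed.

(** The inner binomials ['C(p, i)] vanish in characteristic [p]. *)
Lemma iter_twisted_Leibniz_pchar (R : nzRingType) p (D D1 D2 : {additive R -> R}) :
  p \in [pchar R] -> (forall u v, D (u * v) = D1 u * v + u * D2 v) ->
  forall u v, iter p D (u * v) = iter p D1 u * v + u * iter p D2 v.
Proof.
move=> pR DM u v; have p_pr := pcharf_prime pR.
case: p p_pr pR => // p p_pr pR.
rewrite (iter_twisted_Leibniz DM) big_ord_recl big_ord_recr /= bin0 mulr1n.
rewrite /bump /= add1n binn subnn mulr1n big1 ?add0r // => i _.
rewrite add1n -mulr_natr.
by rewrite bin_lt_pcharf_0 ?mulr0 //= ltnS ltn_ord.
Qed.

(** * Lie derivatives of densities over [F[X]] and their [p]-th powers *)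

Section PolyDensity.
Variables (F : fieldType) (p : nat).
Hypothesis pcharF : p \in [pchar F].
Implicit Types (c : F) (g h u v : {poly F}).

(* Lie derivative, along the vector field [g d/dX], of the density [h (dX)^c]. *)
Definition pdens c g h : {poly F} := g * h^`() + c%:P * (g^`() * h).

Fact pdens_additive c g : {morph pdens c g : u v / u - v}.
Proof. by move=> u v; rewrite /pdens derivB; ring. Qed.
HB.instance Definition _ c g :=
  GRing.isZmodMorphism.Build _ _ (pdens c g) (pdens_additive c g).

Lemma pdensM c d g u v : pdens (c + d) g (u * v) = pdens c g u * v + u * pdens d g v.
Proof. by rewrite /pdens derivM polyCD; ring. Qed.

Lemma pdens_bracket c g h u : 
  pdens c (g * h^`() - h * g^`()) u = pdens c g (pdens c h u) - pdens c h (pdens c g u).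
Proof. by rewrite /pdens !(derivB, derivD, derivM, derivC); ring. Qed.

Lemma pcharP : p \in [pchar {poly F}].
Proof. by rewrite pchar_poly. Qed.

(** In characteristic [p] the [p]-th power of a derivation is again a derivation, hence determined
    by its value at [X]. *)
Lemma iter_pdens0 g h :
  iter p (pdens 0 g) h = iter p (pdens 0 g) 'X * h^`().
Proof.
have DM u v : pdens 0 g (u * v) = pdens 0 g u * v + u * pdens 0 g v.
  by rewrite -pdensM addr0.
have L := iter_twisted_Leibniz_pchar pcharP DM.
have LD u v : iter p (pdens 0 g) (u + v) = iter p (pdens 0 g) u + iter p (pdens 0 g) v.
  by elim: p => //= n ->; rewrite raddfD.
have LC c : iter p (pdens 0 g) c%:P = 0.
  case: p (pcharf_prime pcharF) => // n _; elim: n => [|n IHn].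
    by rewrite /= /pdens derivC; ring.
  by rewrite iterS IHn raddf0.
elim/poly_ind: h => [|h c IH]; first by rewrite -polyC0 LC derivC mulr0.
by rewrite LD LC L IH derivMXaddC; ring.
Qed.

Lemma deriv1 : (1 : {poly F})^`() = 0.
Proof. exact: derivC. Qed.

(** Induction on [n] through [1 = 1 * 1], with factors of weights [n] and [1]. *)
Lemma iter_pdens_nat1 n g :
  iter p (pdens n%:R g) 1 = (iter p (pdens 0 g) 'X)^`() *+ n.
Proof.
elim: n => [|n IHn].
  by rewrite !mulr0n (iter_pdens0 g 1) deriv1 mulr0.
have -> : iter p (pdens n.+1%:R g) 1 = iter p (pdens (n%:R + 1) g) (1 * 1).
  by rewrite natr1 mulr1.
rewrite (iter_twisted_Leibniz_pchar pcharP (pdensM n%:R 1 g)) IHn mulr1 mul1r mulrSr.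
congr (_ + _); case: p (pcharf_prime pcharF) => // k _.
(* Weight [1] reduces to weight [0]: [d/dX] intertwines the two, as [(g u')' = pdens 1 g u'], and
   the iterations meet after one step since both [pdens 1 g 1] and [(pdens 0 g 'X)'] equal [g']. *)
rewrite !iterSr /=.
have -> : pdens 1 g 1 = (pdens 0 g 'X)^`().
  by rewrite /pdens derivX deriv1 polyC1 !(derivD, derivM, derivC); ring.
elim: k => //= k ->.
by rewrite /pdens !(derivD, derivM, derivC) polyC1; ring.
Qed.

(** Writing [h = h * 1] with weights [0] and [n] combines the two previous computations. The [p]-th
    power of the Lie derivative along [g d/dX] is the one along its [p]-th power, which is what
    restrictedness needs. *)
Lemma iter_pdens n g h :
  iter p (pdens n%:R g) h = pdens n%:R (iter p (pdens 0 g) 'X) h.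
Proof.
have -> : iter p (pdens n%:R g) h = iter p (pdens (0 + n%:R) g) (h * 1).
  by rewrite add0r mulr1.
rewrite (iter_twisted_Leibniz_pchar pcharP (pdensM 0 n%:R g)) (iter_pdens0 g h) iter_pdens_nat1.
by rewrite [RHS]/pdens polyC_natr /= mulr1 mulrnAr mulr_natl [h * _]mulrC.
Qed.

End PolyDensity.

(** * Truncated polynomials, and slices along the first variable *)

Section Slices.
Variables (F : fieldType) (p : nat).
Implicit Types (g h : {poly F}).

Definition mcons m (k : 'I_p) (c : mono p m) : mono p m.+1 :=
  [ffun i => oapp c k (unlift ord0 i)].

Lemma mcons0 m k (c : mono p m) : mcons k c ord0 = k.
Proof. by rewrite ffunE unlift_none. Qed.

Lemma mconsS m k (c : mono p m) i : mcons k c (lift ord0 i) = c i.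
Proof. by rewrite ffunE liftK. Qed.

Definition mtail m (a : mono p m.+1) : mono p m := [ffun i => a (lift ord0 i)].

Lemma mcons_tail m (a : mono p m.+1) : mcons (a ord0) (mtail a) = a.
Proof.
by apply/ffunP=> i; rewrite ffunE; case: unliftP => [j|] -> //=; rewrite ffunE.
Qed.

Lemma mtail_cons m k (c : mono p m) : mtail (mcons k c) = c.
Proof. by apply/ffunP=> i; rewrite ffunE mconsS. Qed.

Lemma mono1P (a b : mono p 1) : a ord0 = b ord0 -> a = b.
Proof. by move=> ab; apply/ffunP=> i; rewrite (ord1 i). Qed.

Lemma forall_ordS m (P : pred 'I_m.+1) :
  [forall i, P i] = P ord0 && [forall i, P (lift ord0 i)].
Proof.
apply/forallP/andP => [Pi | [P0 /forallP PS] i]; first by split=> //; apply/forallP.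
by case: (unliftP ord0 i) => [j|] ->.
Qed.

Definition tpoly g : An F p 1 := [ffun a : mono p 1 => g`_(a ord0)].
(** The representative of degree below [p]. Identities are proved for such lifts in [F[X]] and then
    truncated. *)
Definition polyA (f : An F p 1) : {poly F} := \sum_(a : mono p 1) (f a : F) *: 'X^(a ord0).

Fact tpoly_linear : linear tpoly.
Proof. by move=> c g h; apply/ffunP=> a; rewrite !ffunE coefD coefZ. Qed.
HB.instance Definition _ := GRing.isLinear.Build _ _ _ _ tpoly tpoly_linear.

Fact polyA_linear : linear polyA.
Proof.
move=> c f g; rewrite /polyA scaler_sumr -big_split; apply: eq_bigr => a _ /=.
by rewrite !ffunE scalerDl scalerA.
Qed.
HB.instance Definition _ := GRing.isLinear.Build _ _ _ _ polyA polyA_linear.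

Lemma coef_polyA f (a : mono p 1) : (polyA f)`_(a ord0) = f a.
Proof.
rewrite coef_sum (bigD1 a) //= coefZ coefXn eqxx mulr1 big1 ?addr0 // => b ba.
rewrite coefZ coefXn; case: eqP => [/val_inj/mono1P ab|]; last by rewrite mulr0.
by rewrite ab eqxx in ba.
Qed.

Lemma polyAK : cancel polyA tpoly.
Proof. by move=> f; apply/ffunP=> a; rewrite ffunE coef_polyA. Qed.

Lemma tpolyP g h : (forall k, (k < p)%N -> g`_k = h`_k) <-> tpoly g = tpoly h.
Proof.
split=> [gh | /ffunP gh k kp]; first by apply/ffunP=> a; rewrite !ffunE gh.
by have:= gh [ffun _ => Ordinal kp]; rewrite !ffunE.
Qed.

(** The [k]-th coefficient of a product only involves coefficients of index at most [k]: the kernel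
    of truncation is an ideal. *)
Lemma tpolyM_congr g g' h h' :
  tpoly g = tpoly g' -> tpoly h = tpoly h' -> tpoly (g * h) = tpoly (g' * h').
Proof.
move=> /tpolyP gg /tpolyP hh; apply/tpolyP => k kp; rewrite !coefM.
apply: eq_bigr => i _; congr (_ * _).
  by apply: gg; apply: leq_ltn_trans kp; rewrite -ltnS.
by apply: hh; apply: leq_ltn_trans kp; apply: leq_subr.
Qed.

Definition slice m (c : mono p m) (f : An F p m.+1) : An F p 1 :=
  [ffun a : mono p 1 => f (mcons (a ord0) c)].

Fact slice_linear m (c : mono p m) : linear (slice c).
Proof. by move=> k f g; apply/ffunP=> a; rewrite !ffunE. Qed.
HB.instance Definition _ m (c : mono p m) :=
  GRing.isLinear.Build _ _ _ _ (slice c) (slice_linear c).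

Lemma sliceP m (f g : An F p m.+1) : (forall c, slice c f = slice c g) -> f = g.
Proof.
move=> fg; apply/ffunP=> a; have /ffunP/(_ [ffun _ => a ord0]) := fg (mtail a).
by rewrite !ffunE mcons_tail.
Qed.

Lemma slice1 (c : mono p 0) f : slice c f = f.
Proof. by apply/ffunP=> a; rewrite ffunE; congr (f _); apply: mono1P; rewrite mcons0. Qed.

(** The coefficient of [theta] involves only the first variable, so multiplying by it preserves the
    monomial [c] in the other variables. *)
Lemma slice_amul_theta m (x : Wn F p 1) (g : An F p m.+1) (c : mono p m) :
  slice c (amul (theta m.+1 x ord0) g) = tpoly (polyA (x ord0) * polyA (slice c g)).
Proof.
apply/ffunP=> k; rewrite !ffunE.
pose z : 'I_p := Ordinal (leq_ltn_trans (leq0n _) (ltn_ord (k ord0))).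
rewrite big_distrlr /= coef_sum.
under [RHS]eq_bigr => a _ do rewrite coef_sum.
rewrite [RHS]pair_big [LHS]pair_big_dep /=.
under [RHS]eq_bigr => ab _.
  rewrite -scalerAl -scalerAr -exprD !coefZ coefXn.
  over.
(* Terms whose left exponent involves a further variable vanish by definition of [theta]. In the
   others the right exponent has tail [c], so the two first exponents index the sum. *)
pose tail0 (a : mono p m.+1) := [forall i, val (a (lift ord0 i)) == 0%N].
rewrite (bigID (fun ab : mono p m.+1 * mono p m.+1 => tail0 ab.1)) /=.
rewrite [X in _ + X]big1 ?addr0; last first.
  move=> ab /andP[_ nt]; rewrite ffunE forall_ordS /=.
  by rewrite -/(tail0 ab.1) (negbTE nt) mul0r.
pose hh (q : mono p 1 * mono p 1) :=
  (mcons (q.1 ord0) [ffun _ : 'I_m => z], mcons (q.2 ord0) c).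
pose hh' (q : mono p m.+1 * mono p m.+1) : mono p 1 * mono p 1 :=
  ([ffun _ => q.1 ord0], [ffun _ => q.2 ord0]).
rewrite (reindex_onto hh hh'); last first.
  case=> a b /= /andP[]; rewrite forall_ordS mcons0 => /andP[_ /forallP bc] /forallP a0.
  have za i : a (lift ord0 i) = z by apply/val_inj/eqP/a0.
  rewrite /hh /hh' /= !ffunE; congr (_, _).
    by rewrite -[RHS]mcons_tail; congr mcons; apply/ffunP=> i; rewrite !ffunE za.
  rewrite -[RHS]mcons_tail; congr mcons; apply/ffunP=> i; rewrite !ffunE.
  by apply/val_inj/eqP; have:= bc i; rewrite mconsS za add0n eq_sym.
rewrite big_mkcond [RHS]big_mkcond /=; apply: eq_bigr => -[a b] _ /=.
rewrite !forall_ordS !mcons0.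
have -> : [forall i, (mcons (a ord0) [ffun=> z] (lift ord0 i) + mcons (b ord0) c (lift ord0 i)
    == mcons (k ord0) c (lift ord0 i))%N].
  by apply/forallP=> i; rewrite !mconsS ffunE add0n.
have tz : tail0 (mcons (a ord0) [ffun=> z]) by apply/forallP=> i; rewrite mconsS ffunE.
have -> : hh' (hh (a, b)) == (a, b).
  by apply/eqP; rewrite /hh' /hh /= !mcons0; congr (_, _); apply: mono1P; rewrite ffunE.
rewrite tz !andbT eq_sym; case: eqP => _; last by rewrite !mulr0.
rewrite mulr1 [X in X * _ = _]ffunE forall_ordS /= -/(tail0 _) tz [slice _ _ _]ffunE.
by congr (x ord0 _ * _); apply: mono1P; rewrite ffunE mcons0.
Qed.

Lemma slice_apart0 m (g : An F p m.+1) (c : mono p m) :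
  slice c (apart ord0 g) = tpoly (polyA (slice c g))^`().
Proof.
apply/ffunP=> k; rewrite !ffunE raddf_sum coef_sum /=.
rewrite (reindex_onto (fun a : mono p 1 => mcons (a ord0) c)
  (fun b => [ffun _ => b ord0])); last first.
  move=> b; rewrite forall_ordS => /andP[_ /forallP bc]; rewrite ffunE.
  rewrite -[RHS]mcons_tail; congr mcons; apply/ffunP=> i; rewrite ffunE.
  by apply/val_inj/eqP; have:= bc i; rewrite mconsS /= addn0 eq_sym.
rewrite big_mkcond; apply: eq_bigr => a _.
rewrite forall_ordS !mcons0 eqxx addn1.
have -> : [forall i, val (mcons (a ord0) c (lift ord0 i)) ==
    (val (mcons (k ord0) c (lift ord0 i)) + (lift ord0 i == ord0))%N].
  by apply/forallP=> i; rewrite !mconsS addn0.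
have -> : [ffun=> a ord0] == a by apply/eqP/mono1P; rewrite ffunE.
rewrite !andbT ffunE derivZ derivXn coefZ coefMn coefXn.
case: eqP => [->|]; first by rewrite eqxx mulrC.
(* The exponent [0] is its own truncated predecessor, but the factor [0] produced by differentiation
   removes that term. *)
case: (a ord0) => -[|i] ip ak /=; first by rewrite mulr0n mulr0.
by case: eqP ak => [->//|]; rewrite mul0rn mulr0.
Qed.

End Slices.

Lemma hom_of_linear (F : fieldType) (V N : vectType F) (f : V -> N) :
  linear f -> exists h : 'Hom(V, N), h =1 f.
Proof.
move=> lin_f; pose fL := GRing.isLinear.Build F V N _ f lin_f.
pose f' : {linear V -> N} := HB.pack f fL.
by exists (linfun f') => v; rewrite lfunE.
Qed.

(** * Densities on [A(1)] as restricted [W(1)]-modules *)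

Section Density.
Variables (F : fieldType) (p : nat).
Hypothesis pcharF : p \in [pchar F].
Implicit Types (c : F) (g h : {poly F}).

Let p_pr := pcharf_prime pcharF.

(** The coefficient of [X^(p-1)] in a derivative carries the factor [p = 0], so the unknown
    coefficient of [X^p] does no harm and [d/dX] descends to [F[X]/(X^p)]. *)
Lemma tpoly_deriv_congr g h :
  tpoly p g = tpoly p h -> tpoly p g^`() = tpoly p h^`().
Proof.
move=> /tpolyP gh; apply/tpolyP => k kp; rewrite !coef_deriv.
have [kp'|] := ltnP k.+1 p; first by rewrite gh.
move=> pk; have -> : k.+1 = p by apply/eqP; rewrite eqn_leq kp pk.
by rewrite -[LHS]mulr_natr -[RHS]mulr_natr pcharf0 // !mulr0.
Qed.

Definition wvec g : Wn F p 1 := [ffun _ => tpoly p g].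

Lemma wvecK (x : Wn F p 1) : wvec (polyA (x ord0)) = x.
Proof. by apply/ffunP=> i; rewrite ffunE polyAK (ord1 i). Qed.

Lemma wbasisE a : wbasis F p a = wvec 'X^a.
Proof.
by apply/ffunP=> i; apply/ffunP=> al; rewrite !ffunE coefXn; case: eqP.
Qed.

Definition dens c (x : Wn F p 1) (f : An F p 1) : An F p 1 :=
  tpoly p (pdens c (polyA (x ord0)) (polyA f)).

(** The kernel of truncation is an ideal stable under [d/dX], so the action does not depend on the
    lifts. *)
Lemma densE c g h : dens c (wvec g) (tpoly p h) = tpoly p (pdens c g h).
Proof.
rewrite /dens /pdens ffunE !raddfD /=; congr (_ + _).
  by apply: tpolyM_congr; rewrite ?polyAK //; apply: tpoly_deriv_congr; rewrite polyAK.
apply: tpolyM_congr => //; apply: tpolyM_congr; rewrite ?polyAK //.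
by apply: tpoly_deriv_congr; rewrite polyAK.
Qed.

Lemma iter_dens c g h n :
  iter n (dens c (wvec g)) (tpoly p h) = tpoly p (iter n (pdens c g) h).
Proof. by elim: n => //= n ->; rewrite densE. Qed.

(** For one variable [theta] is the identity and there is a single slice, so this is the slice
    formula with [m = 0]. *)
Lemma amul1 (f g : An F p 1) : amul f g = tpoly p (polyA f * polyA g).
Proof.
have := slice_amul_theta [ffun _ => f] g (ffun0 (card_ord 0)).
have fE : ([ffun _ => f] : Wn F p 1) ord0 = f by rewrite ffunE.
rewrite !slice1 fE => <-; congr (amul _ _); apply/ffunP=> a; rewrite !ffunE /=.
case: ifP => [_|/forallP[]]; last by move=> k; rewrite (ord1 k).
by congr (f _); apply: mono1P; rewrite ffunE.
Qed.

Lemma apart1 (f : An F p 1) : apart ord0 f = tpoly p (polyA f)^`().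
Proof.
have := slice_apart0 f (ffun0 (card_ord 0)).
by rewrite !slice1.
Qed.

Lemma dact1 (x : Wn F p 1) f : dact x f = dens 0 x f.
Proof.
rewrite /dact big_ord1 amul1 apart1 /dens /pdens polyC0 mul0r addr0.
by apply: tpolyM_congr; rewrite ?polyAK.
Qed.

Lemma wbr_wvec g h : wbr (wvec g) (wvec h) = wvec (g * h^`() - h * g^`()).
Proof.
apply/ffunP=> i; rewrite !ffunE !dact1 !densE -raddfB /pdens polyC0.
by congr (tpoly p _); ring.
Qed.

Lemma wpow_wvec g : wpow (wvec g) = wvec (iter p (pdens 0 g) 'X).
Proof.
apply/ffunP=> i; rewrite !ffunE (ord1 i) -iter_dens.
have -> : xvar F p ord0 = tpoly p 'X.
  apply/ffunP=> a; rewrite !ffunE coefX.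
  have -> : [forall k, val (a k) == (k == ord0)] = (val (a ord0) == 1%N).
    by apply/forallP/idP => [/(_ ord0)//|a1 k]; rewrite (ord1 k).
  by case: eqP.
by apply: eq_iter => f; rewrite dact1.
Qed.

Lemma dens_linearl c a x y f : dens c (a *: x + y) f = a *: dens c x f + dens c y f.
Proof.
rewrite /dens !ffunE (linearP (@polyA F p)) -(linearP (@tpoly F p)) /=; congr (tpoly p _).
by rewrite /pdens !derivD !derivZ -!mul_polyC; ring.
Qed.

Lemma dens_linearr c x : linear (dens c x).
Proof.
move=> a u v; rewrite /dens (linearP (@polyA F p)) -(linearP (@tpoly F p)) /=; congr (tpoly p _).
by rewrite /pdens !derivD !derivZ -!mul_polyC; ring.
Qed.

HB.instance Definition _ c x :=
  GRing.isLinear.Build _ _ _ _ (dens c x) (dens_linearr c x).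

Lemma dens_w1mod c : is_w1mod (dens c).
Proof.
split=> [||x y f]; [exact: dens_linearl | exact: dens_linearr |].
rewrite -(wvecK x) -(wvecK y) -(polyAK f) wbr_wvec !densE pdens_bracket.
by rewrite raddfB.
Qed.

Lemma dens_restricted n : restricted (dens n%:R).
Proof.
move=> x f; rewrite -(wvecK x) -(polyAK f) wpow_wvec iter_dens densE.
by rewrite iter_pdens.
Qed.

Lemma dens_partial c f : dens c (wbasis F p 0) f = tpoly p (polyA f)^`().
Proof.
by rewrite wbasisE -{1}(polyAK f) densE /pdens expr0 deriv1 mul0r mulr0 mul1r addr0.
Qed.

Lemma dens_wbasis c a k : dens c (wbasis F p a.+1) (tpoly p 'X^k) =
  (k%:R + c * a.+1%:R) *: tpoly p 'X^(k + a).
Proof.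
rewrite wbasisE densE -linearZ /=; congr (tpoly p _).
rewrite /pdens !derivXn -mul_polyC polyCD polyCM !polyC_natr exprD.
by case: k => [|k] /=; rewrite ?exprS; ring.
Qed.

Lemma tpolyX0 k : (p <= k)%N -> tpoly p 'X^k = 0 :> An F p 1.
Proof.
move=> pk; apply/ffunP=> a; rewrite !ffunE coefXn; case: eqP => // ak.
by have:= ltn_ord (a ord0); rewrite ak ltnNge pk.
Qed.

Lemma tpoly_span (f : An F p 1) : f = \sum_(a : mono p 1) (f a : F) *: tpoly p 'X^(a ord0).
Proof.
rewrite -{1}(polyAK f) /polyA raddf_sum; apply: eq_bigr => a _.
by rewrite /= linearZ.
Qed.

Lemma wbasis_span (x : Wn F p 1) :
  x = \sum_(a : mono p 1) (x ord0 a : F) *: wbasis F p (a ord0).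
Proof.
apply/ffunP=> i; rewrite sum_ffunE (ord1 i) {1}(tpoly_span (x ord0)).
by apply: eq_bigr => a _; rewrite wbasisE !ffunE.
Qed.

Lemma natp_neq0 k : (0 < k < p)%N -> k%:R != 0 :> F.
Proof.
case/andP=> k0 kp; rewrite -(dvdn_pcharf pcharF); apply: contraTN kp.
by move=> /dvdn_leq; rewrite -leqNgt; apply.
Qed.

Lemma tpoly_ind (Q : An F p 1 -> Prop) :
  Q 0 -> (forall (a : F) u v, Q u -> Q v -> Q (a *: u + v)) ->
  (forall k, (k < p)%N -> Q (tpoly p 'X^k)) -> forall u, Q u.
Proof.
move=> Q0 Qlin QX u; rewrite (tpoly_span u).
by elim/big_rec: _ => // a v _; apply: Qlin; apply: QX.
Qed.

(** The exponents [1, .., p-1] are invertible in [F], so [X^(p-1)] generates all monomials under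
    [d/dX], whatever the weight. *)
Lemma dens_ind c (Q : An F p 1 -> Prop) :
  Q (tpoly p 'X^(p.-1)) -> (forall u, Q u -> Q (dens c (wbasis F p 0) u)) ->
  (forall (a : F) u v, Q u -> Q v -> Q (a *: u + v)) -> forall u, Q u.
Proof.
move=> Qv Qd Qlin.
have Q0 : Q 0 by rewrite -(addNr (tpoly p 'X^(p.-1))) -scaleN1r; apply: Qlin.
have QX k : (k < p)%N -> Q (tpoly p 'X^(p.-1 - k)).
  elim: k => [|k IHk] kp; first by rewrite subn0.
  have := Qd _ (IHk (ltnW kp)); set j := (p.-1 - k)%N.
  have j0 : (0 < j < p)%N.
    rewrite subn_gt0 -ltnS prednK ?prime_gt0 // kp.
    by rewrite (leq_ltn_trans (leq_subr _ _)) // prednK ?prime_gt0.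
  rewrite wbasisE densE /pdens expr0 deriv1 mul0r mulr0 mul1r addr0 derivXn => Qj.
  have := Qlin j%:R^-1 _ _ Qj Q0.
  rewrite -scaler_nat linearZ scalerA mulVf ?natp_neq0 // scale1r addr0.
  by rewrite /j subnS.
apply: tpoly_ind => // k kp; have := QX (p.-1 - k)%N.
have kp1 : (k <= p.-1)%N by rewrite -ltnS prednK ?prime_gt0.
by rewrite subKn //; apply; rewrite (leq_ltn_trans (leq_subr _ _)) // prednK ?prime_gt0.
Qed.

End Density.

(** * Arbitrary [W(1)]-modules *)

Section W1modules.
Variables (F : fieldType) (p : nat).
Hypothesis pcharF : p \in [pchar F].
Variables (V : vectType F) (act : Wn F p 1 -> V -> V).
Hypothesis act_mod : is_w1mod act.

Lemma w1mod0r x : act x 0 = 0.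
Proof.
case: act_mod => _ /(_ x 1 0 0) + _; rewrite !scale1r addr0 => /esym/eqP.
by rewrite -subr_eq0 addrK => /eqP.
Qed.

Lemma w1mod0l v : act 0 v = 0.
Proof.
case: act_mod => /(_ 1 0 0 v) + _ _; rewrite !scale1r addr0 => /esym/eqP.
by rewrite -subr_eq0 addrK => /eqP.
Qed.

Lemma w1modZr x a u : act x (a *: u) = a *: act x u.
Proof. by case: act_mod => _ /(_ x a u 0) + _; rewrite w1mod0r !addr0. Qed.

Lemma w1modZl a x u : act (a *: x) u = a *: act x u.
Proof. by case: act_mod => /(_ a x 0 u) + _ _; rewrite w1mod0l !addr0. Qed.

Lemma w1mod_span x v :
  act x v = \sum_(a : mono p 1) (x ord0 a : F) *: act (wbasis F p (a ord0)) v.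
Proof.
rewrite {1}(wbasis_span x); elim/big_rec2: _ => [|a y u _ <-]; first exact: w1mod0l.
by case: act_mod => ->.
Qed.

(** This is [[d, x^(a+1) d] = (a+1) x^a d]. It carries a property of the operators [x^a d] from a
    vector [v] to [d v]. *)
Lemma w1mod_wbasisS a v :
  act (wbasis F p a.+1) (act (wbasis F p 0) v) =
  act (wbasis F p 0) (act (wbasis F p a.+1) v) - a.+1%:R *: act (wbasis F p a) v.
Proof.
rewrite -w1modZl; have -> : a.+1%:R *: wbasis F p a = wbr (wbasis F p 0) (wbasis F p a.+1).
  rewrite !wbasisE wbr_wvec //; apply/ffunP=> i; rewrite !ffunE -linearZ /=.
  by rewrite expr0 deriv1 mulr0 subr0 mul1r derivXn scaler_nat.
by case: act_mod => _ _ ->; rewrite subKr.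
Qed.

End W1modules.

Lemma intertw_wbasis (F : fieldType) p (V N : vectType F)
    (actV : Wn F p 1 -> V -> V) (actN : Wn F p 1 -> N -> N) (f : 'Hom(V, N)) :
  is_w1mod actV -> is_w1mod actN ->
  (forall a u, (a < p)%N -> f (actV (wbasis F p a) u) = actN (wbasis F p a) (f u)) ->
  intertw actV actN f.
Proof.
move=> modV modN fa x u; rewrite (w1mod_span modV) (w1mod_span modN) linear_sum.
by apply: eq_bigr => a _ /=; rewrite linearZ /= fa ?ltn_ord.
Qed.

(** * Densities as baby Verma modules *)

Section Verma.
Variables (F : fieldType) (p : nat).
Hypothesis pcharF : p \in [pchar F].

Let p_pr := pcharf_prime pcharF.
Let p_gt0 := prime_gt0 p_pr.

Lemma fact_neq0 k : (k < p)%N -> k`!%:R != 0 :> F.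
Proof.
elim: k => [|k IHk] kp; first by rewrite oner_neq0.
by rewrite factS natrM mulf_neq0 ?IHk ?(natp_neq0 pcharF) ?(ltnW kp).
Qed.

Lemma dens_wbasis0 c k : dens c (wbasis F p 0) (tpoly p 'X^k) = k%:R *: tpoly p 'X^(k.-1).
Proof.
rewrite wbasisE densE // /pdens expr0 deriv1 mul0r mulr0 mul1r addr0 derivXn.
by rewrite -scaler_nat linearZ.
Qed.

(** Already [d^2] kills [X], and [p >= 2]. *)
Lemma wpow_wbasis0 : wpow (wbasis F p 0) = 0.
Proof.
rewrite wbasisE wpow_wvec //; apply/ffunP=> i; rewrite !ffunE.
have -> : iter p (pdens 0 ('X^0 : {poly F})) 'X = 0; last by rewrite raddf0.
case: p (prime_gt1 p_pr) => [|[|k]] // _; elim: k => [|k IHk].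
  by rewrite /= /pdens !polyC0 expr0 !mul0r !addr0 !mul1r derivX deriv1.
by rewrite iterS IHk raddf0.
Qed.

(** The weight of [X^(p-1)] is [(p-1) + (lam+1) = lam] in [F], and fields of positive degree push it
    past the truncation. *)
Lemma dens_hw lam : hw (dens lam.+1%:R) lam (tpoly p 'X^(p.-1) : An F p 1).
Proof.
split=> [|[|[|a]] // /andP[_ ap]].
  by rewrite dens_wbasis // addn0 mulr1 -natrD addnS -addSn prednK // natrD (pcharf0 pcharF) add0r.
rewrite dens_wbasis // tpolyX0 ?scaler0 //.
by rewrite addnS -addSn prednK // leq_addr.
Qed.

(* The universal map is forced by [d^(p-1-k) X^(p-1) = (p-1)!/k! X^k]. *)
Lemma dens_verma lam : is_verma lam (dens lam.+1%:R : Wn F p 1 -> An F p 1 -> An F p 1).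
Proof.
split; [exact: dens_w1mod | exact: dens_restricted |].
have dens_mod := dens_w1mod pcharF lam.+1%:R.
exists (tpoly p 'X^(p.-1)); split=> [|N act act_mod act_res w [w1 w2]]; first exact: dens_hw.
pose D := act (wbasis F p 0).
pose t k := (k`!%:R / (p.-1)`!%:R) *: iter (p.-1 - k) D w.
have [|f fE] := @hom_of_linear F (An F p 1) N
  (fun u => \sum_(a : mono p 1) (u a : F) *: t (a ord0)).
  move=> a u v; rewrite scaler_sumr -big_split; apply: eq_bigr => b _ /=.
  by rewrite !ffunE scalerDl -scalerA.
have fX k : (k < p)%N -> f (tpoly p 'X^k) = t k.
  move=> kp; rewrite fE (bigD1 [ffun _ => Ordinal kp]) //= !ffunE coefXn /= eqxx scale1r.
  rewrite big1 ?addr0 // => b bk; rewrite ffunE coefXn; case: eqP => [bE|]; last by rewrite scale0r.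
  by case/eqP: bk; apply: mono1P; rewrite ffunE; apply: val_inj.
have fv : f (tpoly p 'X^(p.-1)) = w.
  by rewrite fX ?prednK // /t subnn /= divff ?scale1r ?fact_neq0 ?prednK.
have D0 : D 0 = 0 := w1mod0r act_mod (wbasis F p 0).
have fD u : f (dens lam.+1%:R (wbasis F p 0) u) = D (f u).
  move: u; apply: tpoly_ind => [|a u v IHu IHv|k kp].
  - by rewrite (w1mod0r dens_mod) linear0 D0.
  - rewrite (dens_linearr lam.+1%:R) !linearP /= IHu IHv.
    by rewrite /D; case: act_mod => _ -> _.
  rewrite dens_wbasis0 linearZ /= (fX k kp); case: k kp => [|k] kp.
    (* As [d/dX] kills the constants, [D] has to kill [t 0], a multiple of [D^(p-1) w].
       Restrictedness of the target gives [D^p = 0]. *)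
    rewrite scale0r /t /D (w1modZr act_mod) subn0 -/D -iterS prednK //.
    by rewrite act_res wpow_wbasis0 (w1mod0l act_mod) scaler0.
  rewrite fX ?(ltnW kp) // /t /D (w1modZr act_mod) scalerA -/D -iterS factS natrM mulrA.
  by rewrite subnSK // -ltnS prednK.
have f_int : intertw (dens lam.+1%:R) act f.
  apply: intertw_wbasis => // a u; move: u a.
  (* For all [a] at once, the claim passes from [u] to its derivative by the commutation rule. Only
     the generator uses the hypotheses on [w]. *)
  apply: (dens_ind pcharF (c := lam.+1%:R)) => [[|[|a]] ap|u IHu [|a] ap|b u v IHu IHv a ap].
  - by rewrite fD fv.
  - by rewrite (dens_hw lam).1 linearZ /= fv w1.
  - by rewrite (dens_hw lam).2 ?linear0 ?fv ?w2.
  - by rewrite fD.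
  - rewrite (w1mod_wbasisS pcharF dens_mod) linearB linearZ /= !fD !IHu ?(ltnW ap) //.
    by rewrite (w1mod_wbasisS pcharF act_mod).
  rewrite (dens_linearr lam.+1%:R) !linearP /= IHu // IHv //.
  by case: act_mod => _ -> _.
exists f; split=> // g [g_int gv]; apply/lfunP.
apply: (dens_ind pcharF (c := lam.+1%:R)) => [|u IHu|b u v IHu IHv].
- by rewrite fv gv.
- by rewrite f_int g_int IHu.
by rewrite !linearP /= IHu IHv.
Qed.

End Verma.

(** * The simple modules [L(p-2)], [L(0)] and [L(p-1)] *)

Section SimpleModules.
Variables (F : fieldType) (p : nat).
Hypothesis pcharF : p \in [pchar F].

Let p_pr := pcharf_prime pcharF.
Let p_gt0 := prime_gt0 p_pr.

Lemma dens_verma_pred1 : is_verma (p - 1) (dens 0 : Wn F p 1 -> _).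
Proof. by have := dens_verma pcharF (p - 1); rewrite subn1 prednK // pcharf0. Qed.

Lemma dens_verma0 : is_verma 0 (dens 1 : Wn F p 1 -> _).
Proof. exact: dens_verma. Qed.

Lemma natp_pred1 : p.-1%:R = -1 :> F.
Proof. by apply/eqP; rewrite -addr_eq0 natr1 prednK // pcharf0. Qed.

Lemma dens_verma_pred2 : (2 < p)%N -> is_verma (p - 2) (dens (-1) : Wn F p 1 -> _).
Proof.
move=> p3; have := dens_verma pcharF (p - 2).
by rewrite -subSn ?(ltnW p3) // subSS subn1 natp_pred1.
Qed.

Lemma size_polyA (f : An F p 1) : (size (polyA f) <= p)%N.
Proof.
apply/leq_sizeP => j pj; rewrite coef_sum big1 // => a _; rewrite coefZ coefXn.
by case: eqP pj => [->|_ _]; rewrite ?mulr0 // leqNgt ltn_ord.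
Qed.

(** The degree lies between [1] and [p-1], hence is invertible, and the leading term survives. *)
Lemma deriv_neq0 (g : {poly F}) : (1 < size g <= p)%N -> g^`() != 0.
Proof.
case/andP=> g1 gp; apply/eqP => /(congr1 (fun h : {poly F} => h`_((size g).-2))).
rewrite coef0 coef_deriv; case sg: (size g) g1 gp => [|[|k]] //= _ kp /eqP.
rewrite -mulr_natr mulf_eq0 (negbTE (natp_neq0 pcharF _)) // orbF.
have -> : g`_k.+1 = lead_coef g by rewrite lead_coefE sg.
by rewrite lead_coef_eq0 -size_poly_eq0 sg.
Qed.

Lemma tpoly1_neq0 : tpoly p 1 != 0 :> An F p 1.
Proof.
apply/eqP => /ffunP/(_ [ffun _ => Ordinal p_gt0]); rewrite !ffunE coef1 /= => /eqP.
by rewrite oner_eq0.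
Qed.

(** Differentiating a nonzero element of [U] repeatedly ends at a nonzero constant. *)
Lemma dens_stable1 c (U : {vspace An F p 1}) :
  (forall x u, u \in U -> dens c x u \in U) -> U != 0%VS -> tpoly p 1 \in U.
Proof.
move=> Ust; rewrite -vpick0; have := memv_pick U; set v := vpick U.
move=> vU v0; have: polyA v != 0 by apply: contra_neq v0 => pv; rewrite -(polyAK v) pv raddf0.
have := size_polyA v; rewrite -{}(polyAK v) in vU.
move: (polyA v) vU => {v v0} g; have [n] := ubnP (size g).
elim: n g => // n IHn g gn gU gp g0.
have [g1|g1] := ltnP 1 (size g).
  have dg : g^`() != 0 by rewrite deriv_neq0 ?g1.
  apply: (IHn g^`()) => //; last exact: leq_trans (ltnW (lt_size_deriv g0)) gp.
    by apply: leq_trans (lt_size_deriv g0) _.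
  have := Ust (wbasis F p 0) _ gU.
  by rewrite wbasisE densE // /pdens expr0 deriv1 mul0r mulr0 mul1r addr0.
have gc := size1_polyC g1; have c0 : g`_0 != 0 by rewrite gc polyC_eq0 in g0.
have := memvZ (g`_0)^-1 gU; rewrite -linearZ /= {2}gc -mul_polyC -polyCM mulVf //.
Qed.

(** The field [x^(k+1) d] sends [1] to [c (k+1) X^k]. For [k = p-1] the coefficient is zero, and for
    [c = 1] the monomial [X^(p-1)] is indeed missing from the submodule of exact forms. *)
Lemma dens_stable_sub c (U : {vspace An F p 1}) : c != 0 ->
  (forall x u, u \in U -> dens c x u \in U) -> U != 0%VS ->
  forall k, (k < p.-1)%N -> tpoly p 'X^k \in U.
Proof.
move=> c0 Ust U0 k kp; have := Ust (wbasis F p k.+1) _ (dens_stable1 Ust U0).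
have -> : 1 = 'X^0 :> {poly F} by rewrite expr0.
rewrite dens_wbasis // add0r => /(memvZ (c * k.+1%:R)^-1).
rewrite scalerA mulVf ?scale1r ?add0n // mulf_neq0 // (natp_neq0 pcharF) //.
by rewrite /= -ltnS prednK in kp *.
Qed.

(** Here the baby Verma module is itself simple, so the quotient map is the identity. *)
Lemma is_L_pred2 : (2 < p)%N -> is_L (p - 2) (dens (-1) : Wn F p 1 -> _).
Proof.
move=> p3; split; first exact: dens_w1mod.
  split=> [|U Ust].
    rewrite lt0n dimv_eq0; apply/eqP => /vspaceP/(_ (tpoly p 1)).
    by rewrite memvf memv0 (negbTE tpoly1_neq0).
  have [->|U0] := eqVneq U 0%VS; [by left | right].
  have N10 : -1 != 0 :> F by rewrite oppr_eq0 oner_eq0.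
  have UX := dens_stable_sub N10 Ust U0.
  (* The missing monomial comes from [x^(p-1) d] applied to [X], with coefficient [1 - (p-1) = 2],
     invertible because [p > 2]. *)
  have UXp : tpoly p 'X^(p.-1) \in U.
    have p1 : (1 < p.-1)%N by rewrite -ltnS prednK.
    have p2 : p.-2.+1 = p.-1 by rewrite prednK // ltnW.
    have := Ust (wbasis F p p.-2.+1) _ (UX 1%N p1).
    rewrite dens_wbasis // add1n p2 natp_pred1 mulrNN mulr1 => /(memvZ 2^-1).
    by rewrite scalerA mulVf ?scale1r // (natp_neq0 pcharF).
  apply/vspaceP => u; rewrite memvf; apply: (tpoly_ind (Q := fun u => u \in U)).
  - exact: mem0v.
  - by move=> a v w vU wU; rewrite memvD ?memvZ.
  move=> k kp; have [kp1|] := ltnP k p.-1; first exact: UX.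
  by move=> pk; have -> : k = p.-1 by apply/eqP; rewrite eqn_leq pk -ltnS prednK ?kp.
exists (An F p 1 : vectType F), (dens (-1)); split; first exact: dens_verma_pred2.
exists \1%VF; split=> [x u|]; first by rewrite !id_lfunE.
by rewrite lim1g.
Qed.

Definition triv_act (x : Wn F p 1) (v : F^o) : F^o := 0.

(** In weight [1] the field [g d/dX] acts by [h |-> (g h)'], and a derivative has no term in
    [X^(p-1)]. Taking that coefficient therefore maps [V(0)] onto the trivial module. *)
Lemma is_L0 : is_L 0 triv_act.
Proof.
split; first by split=> *; rewrite /triv_act ?scaler0 ?addr0 ?subr0.
  split=> [|U _]; first by rewrite dimvf.
  have := dimvS (subvf U); rewrite dimvf /= /dim /=.
  case dU: (\dim U) => [|[|]] // _; [left | right].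
    by apply/eqP; rewrite -dimv_eq0 dU.
  by apply/eqP; rewrite eqEdim subvf dU dimvf.
exists (An F p 1 : vectType F), (dens 1); split; first exact: dens_verma0.
have lt1p : (p.-1 < p)%N by rewrite prednK.
have [|f fE] := @hom_of_linear F (An F p 1) F^o (fun u => u [ffun _ => Ordinal lt1p]).
  by move=> a u v; rewrite !ffunE.
exists f; split=> [x u|].
  rewrite fE /triv_act -(wvecK x) -(polyAK u) densE // !ffunE /=.
  rewrite /pdens polyC1 mul1r addrC -derivM coef_deriv prednK //.
  by rewrite -mulr_natr pcharf0 // mulr0.
apply/vspaceP => a; rewrite memvf; apply/memv_imgP.
exists (a *: tpoly p 'X^(p.-1)); rewrite ?memvf // fE !ffunE coefXn eqxx.
exact: esym (mulr1 a).
Qed.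

(** The de Rham differential, from functions (weight [0]) to one-forms (weight [1]). *)
Definition dpart : 'Hom(An F p 1, An F p 1) := linfun (dens 0 (wbasis F p 0)).

Lemma dpartE f : dpart f = tpoly p (polyA f)^`().
Proof. by rewrite lfunE /= dens_partial. Qed.

Lemma dpart_dens x f : dpart (dens 0 x f) = dens 1 x (dpart f).
Proof.
rewrite -(wvecK x) -(polyAK f) densE // !dpartE densE //.
have E (g : {poly F}) : tpoly p (polyA (tpoly p g))^`() = tpoly p g^`().
  by apply: (tpoly_deriv_congr pcharF); rewrite polyAK.
rewrite E polyAK /pdens polyC0 polyC1 mul0r addr0 derivM; congr (tpoly p _); ring.
Qed.

(** The exact one-forms, which model [V(p-1)] modulo its constants. Their stability makes [vsproj]
    return the value unchanged. *)
Definition exact_act (x : Wn F p 1) (u : subvs_of (limg dpart)) : subvs_of (limg dpart) :=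
  vsproj (limg dpart) (dens 1 x (vsval u)).

Lemma exact_actE x u : vsval (exact_act x u) = dens 1 x (vsval u).
Proof.
rewrite vsprojK //; have /memv_imgP[f _ ->] := subvsP u.
by rewrite -dpart_dens memv_img ?memvf.
Qed.

Lemma exact_act_w1mod : is_w1mod exact_act.
Proof.
have [l1 l2 l3] := dens_w1mod pcharF 1.
by split=> *; apply: subvs_inj; rewrite ?linearP ?linearB /= !exact_actE ?linearP.
Qed.

(** A nonzero submodule, viewed among all one-forms, contains every [X^k] with [k < p-1], and these
    span the exact forms. *)
Lemma exact_act_simple : is_simple exact_act.
Proof.
split=> [|U Ust].
  rewrite lt0n dimv_eq0; apply/eqP => /vspaceP/(_ (vsproj _ (dpart (tpoly p 'X)))).
  rewrite memvf memv0 => /esym/eqP/(congr1 vsval).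
  rewrite vsprojK ?memv_img ?memvf // linear0 dpartE.
  rewrite (tpoly_deriv_congr pcharF (h := 'X)) ?polyAK //.
  by rewrite derivX => /eqP; rewrite (negbTE tpoly1_neq0).
pose U2 := (linfun (@vsval F _ (limg dpart)) @: U)%VS.
have [U20|U20] := eqVneq U2 0%VS.
  left; apply/eqP; rewrite -subv0; apply/subvP => u uU; rewrite memv0.
  have : vsval u \in U2 by apply/memv_imgP; exists u; rewrite ?lfunE.
  by rewrite U20 memv0 => /eqP u0; apply/eqP/subvs_inj; rewrite u0 linear0.
right; apply/vspaceP => u; rewrite memvf.
have U2st x v : v \in U2 -> dens 1 x v \in U2.
  case/memv_imgP => w wU ->; rewrite lfunE /= -exact_actE.
  by apply/memv_imgP; exists (exact_act x w); rewrite ?lfunE ?Ust.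
have U2X := dens_stable_sub (oner_neq0 F) U2st U20.
suff /memv_imgP[w wU] : vsval u \in U2 by rewrite lfunE => /subvs_inj ->.
have /memv_imgP[f _ ->] := subvsP u; move: f; apply: tpoly_ind.
- by rewrite linear0 mem0v.
- by move=> a v w vU wU; rewrite linearP memvD ?memvZ.
move=> k kp; rewrite lfunE /= dens_wbasis0 //.
case: k kp => [|k] kp; first by rewrite scale0r mem0v.
by rewrite memvZ //= U2X // -ltnS prednK.
Qed.

Definition dquo : 'Hom(An F p 1, subvs_of (limg dpart)) :=
  (linfun (vsproj (limg dpart)) \o dpart)%VF.

Lemma dquoE f : vsval (dquo f) = dpart f.
Proof. by rewrite comp_lfunE lfunE /= vsprojK ?memv_img ?memvf. Qed.

Lemma dquo_intertw : intertw (dens 0) exact_act dquo.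
Proof. by move=> x u; apply: subvs_inj; rewrite exact_actE !dquoE dpart_dens. Qed.

Lemma dquo_surj u : exists f, dquo f = u.
Proof.
have /memv_imgP[f _ uE] := subvsP u.
by exists f; apply: subvs_inj; rewrite dquoE.
Qed.

(** After truncation the exponents are below [p], so only constants have zero derivative. *)
Lemma dquo_eq0 f : dquo f = 0 <-> forall a : mono p 1, val (a ord0) != 0%N -> f a = 0.
Proof.
split=> [/(congr1 vsval)|f0]; last first.
  apply: subvs_inj; rewrite dquoE linear0 dpartE -[RHS](raddf0 (@tpoly F p)).
  apply/tpolyP => k kp; rewrite coef0 coef_deriv.
  have [k1p|pk] := ltnP k.+1 p; last first.
    (* The coefficient of [X^p] read by the derivative is zero, as [polyA f] has degree below
       [p]. *)
    by rewrite nth_default ?mul0rn // (leq_trans (size_polyA f)).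
  have := coef_polyA f [ffun _ => Ordinal k1p]; rewrite ffunE /= => ->.
  by rewrite f0 ?mul0rn // ffunE.
rewrite dquoE linear0 dpartE -[RHS](raddf0 (@tpoly F p)) => /tpolyP f0 a a0.
have ap := ltn_ord (a ord0).
have := f0 (a ord0).-1 (leq_ltn_trans (leq_pred _) ap).
rewrite coef0 coef_deriv prednK ?lt0n // coef_polyA => /eqP.
by rewrite -mulr_natr mulf_eq0 (negbTE (natp_neq0 pcharF _)) ?orbF ?lt0n ?a0 // => /eqP.
Qed.

Lemma is_L_pred1 : is_L (p - 1) exact_act.
Proof.
split; [exact: exact_act_w1mod | exact: exact_act_simple |].
exists (An F p 1 : vectType F), (dens 0); split; first exact: dens_verma_pred1.
exists dquo; split; first exact: dquo_intertw.
apply/vspaceP => u; rewrite memvf; have [f <-] := dquo_surj u.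
by rewrite memv_img ?memvf.
Qed.

(** Constants form the trivial submodule [L(0)] of [V(p-1)]. *)
Lemma dens0_const x (f : An F p 1) :
  (forall a : mono p 1, val (a ord0) != 0%N -> f a = 0) -> dens 0 x f = 0.
Proof.
move/dquo_eq0/(congr1 vsval); rewrite dquoE dpartE linear0 => df.
rewrite /dens /pdens polyC0 mul0r addr0.
rewrite -[RHS](raddf0 (@tpoly F p)) -(mulr0 (polyA (x ord0))).
by apply: tpolyM_congr; rewrite ?raddf0.
Qed.

End SimpleModules.

(** * [W(n)] as a direct sum of density modules *)

Section Decomposition.
Variables (F : fieldType) (p m : nat).
Hypothesis pcharF : p \in [pchar F].

Let p_pr := pcharf_prime pcharF.
Let p_gt0 := prime_gt0 p_pr.

Local Notation K := ('I_m.+1 * mono p m)%type.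
Local Notation W := (Wn F p m.+1).
Implicit Types (k : K) (D : W) (x : Wn F p 1).

(** For [k = (j, c)], the coefficient in [A(1)] of [x^c d_j], where [x^c] is a monomial in the
    variables after the first. *)
Definition wslice k D : An F p 1 := slice k.2 (D k.1).

Fact wslice_linear k : linear (wslice k).
Proof. by move=> a D E; rewrite /wslice !ffunE linearP. Qed.
HB.instance Definition _ k := GRing.isLinear.Build _ _ _ _ (wslice k) (wslice_linear k).

Lemma wsliceP D E : (forall k, wslice k D = wslice k E) -> D = E.
Proof. by move=> DE; apply/ffunP=> j; apply: sliceP => c; apply: (DE (j, c)). Qed.

Definition wlift k (f : An F p 1) : W :=
  [ffun j => [ffun a : mono p m.+1 =>
    if (j, mtail a) == k then f [ffun _ => a ord0] else 0]].

Fact wlift_linear k : linear (wlift k).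
Proof.
move=> a f g; apply/ffunP=> j; apply/ffunP=> b; rewrite !ffunE.
by case: ifP => _; rewrite ?ffunE // scaler0 addr0.
Qed.
HB.instance Definition _ k := GRing.isLinear.Build _ _ _ _ (wlift k) (wlift_linear k).

Lemma wslice_lift k k' f : wslice k' (wlift k f) = if k' == k then f else 0.
Proof.
apply/ffunP=> a; rewrite !ffunE mtail_cons -surjective_pairing.
by case: ifP => _; rewrite ?ffunE //; congr (f _); apply: mono1P; rewrite ffunE unlift_none.
Qed.

Lemma wslice_liftK k : cancel (wlift k) (wslice k).
Proof. by move=> f; rewrite wslice_lift eqxx. Qed.

Definition weight k : F := if k.1 == ord0 then -1 else 0.

Lemma amulC n (f g : An F p n) : amul f g = amul g f.
Proof.
apply/ffunP=> c; rewrite !ffunE (exchange_big_dep xpredT) //=.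
apply: eq_bigr => a _; apply: eq_big => [b|b _]; last exact: mulrC.
by apply: eq_forallb => i; rewrite addnC.
Qed.

Lemma amul0 n (f : An F p n) : amul f 0 = 0.
Proof.
by apply/ffunP=> c; rewrite !ffunE big1 // => a _; rewrite big1 // => b _; rewrite ffunE mulr0.
Qed.

Lemma apart0 n i : apart i (0 : An F p n) = 0.
Proof. by apply/ffunP=> c; rewrite !ffunE big1 // => b _; rewrite ffunE mulr0. Qed.

Lemma thetaS x (j : 'I_m.+1) : j != ord0 -> theta m.+1 x j = 0.
Proof. by rewrite ffunE -val_eqE /= => /negbTE ->. Qed.

Lemma apart_theta0 x :
  apart ord0 (theta m.+1 x ord0) = theta m.+1 (wvec p (polyA (x ord0))^`()) ord0.
Proof.
have slE (y : Wn F p 1) c : slice c (theta m.+1 y ord0) =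
    if [forall i, val (c i) == 0%N] then y ord0 else 0.
  apply/ffunP=> a; rewrite [LHS]ffunE [theta _ _ _]ffunE /= [LHS]ffunE forall_ordS /=.
  have -> : [forall i, val (mcons (a ord0) c (lift ord0 i)) == 0%N] = [forall i, val (c i) == 0%N].
    by apply: eq_forallb => i; rewrite mconsS.
  case: ifP => _; last by rewrite ffunE.
  by congr (y _ _); apply: mono1P; rewrite ffunE mcons0.
apply: sliceP => c; rewrite slice_apart0 !slE ffunE.
by case: ifP => // _; rewrite !raddf0.
Qed.

Lemma apart_thetaS x (i : 'I_m.+1) : i != ord0 -> apart i (theta m.+1 x ord0) = 0.
Proof.
move=> i0; apply/ffunP=> a; rewrite !ffunE big1 // => b /forallP/(_ i).
rewrite eqxx addn1 => /eqP bi; rewrite ffunE ifF ?mulr0 //.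
by apply/forallP => /(_ i); rewrite -val_eqE /= in i0 *; rewrite i0 bi.
Qed.

(** For [theta x = g d_1] the [j]-th component of the bracket is [g d_1(D_j) - D(g)] if [j = 1] and
    [g d_1(D_j)] otherwise. As [g] depends only on the first variable, [D(g) = D_1 g'], which gives
    weight [-1] in the first case and [0] in the others. *)
Lemma wslice_wnact k x D : wslice k (wnact x D) = dens (weight k) x (wslice k D).
Proof.
case: k => j c; rewrite /weight /wslice /= ffunE raddfB /=.
have -> : dact (theta m.+1 x) (D j) = amul (theta m.+1 x ord0) (apart ord0 (D j)).
  rewrite /dact (bigD1 ord0) //= big1 ?addr0 // => i i0.
  by rewrite thetaS // amulC amul0.
rewrite /dact.
have Pap : tpoly p (polyA (slice c (apart ord0 (D j)))) = tpoly p (polyA (slice c (D j)))^`().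
  by rewrite polyAK slice_apart0.
rewrite slice_amul_theta (tpolyM_congr (erefl _) Pap).
have [->|j0] := eqVneq j ord0; last first.
  rewrite thetaS // big1 ?raddf0 ?subr0; last by move=> i _; rewrite apart0 amul0.
  by rewrite /dens /pdens polyC0 mul0r !addr0.
rewrite (bigD1 ord0) //= [\sum_(i < _ | _) _]big1 ?addr0; last first.
  by move=> i i0; rewrite apart_thetaS // amul0.
rewrite amulC apart_theta0 slice_amul_theta ffunE.
rewrite (tpolyM_congr (polyAK _) (erefl _)) -raddfB /dens /pdens; congr (tpoly p _).
by rewrite polyCN polyC1; ring.
Qed.

Lemma wlift_dens k x f : wlift k (dens (weight k) x f) = wnact x (wlift k f).
Proof.
apply: wsliceP => k'; rewrite wslice_wnact !wslice_lift.
by case: eqP => [->//|_]; rewrite linear0.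
Qed.

Lemma wlift_sum D : D = \sum_k wlift k (wslice k D).
Proof.
apply: wsliceP => k; rewrite raddf_sum (bigD1 k) //= wslice_liftK big1 ?addr0 // => k' kk'.
by rewrite wslice_lift eq_sym (negbTE kk').
Qed.

Definition wcopy k : {vspace W} := limg (linfun (wlift k)).

Lemma wcopyP k D : D \in wcopy k -> D = wlift k (wslice k D).
Proof. by case/memv_imgP => f _ ->; rewrite lfunE /= wslice_liftK. Qed.

Lemma mem_wcopy k f : wlift k f \in wcopy k.
Proof. by apply/memv_imgP; exists f; rewrite ?memvf ?lfunE. Qed.

Lemma wcopy_stable k : stable (wcopy k).
Proof. by move=> x D /wcopyP->; rewrite -wlift_dens mem_wcopy. Qed.

Lemma wcopy_intertw k :
  intertw (dens (weight k)) (@wnact F p m.+1) (linfun (wlift k)).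
Proof. by move=> x u; rewrite !lfunE /= wlift_dens. Qed.

Lemma wlift_lker0 k : lker (linfun (wlift k)) = 0%VS.
Proof.
by apply/eqP/lker0P => f g; rewrite !lfunE /=; apply: (can_inj (wslice_liftK k)).
Qed.

Lemma wcopy_verma k : k.1 != ord0 -> sub_iso_verma (p - 1) (wcopy k).
Proof.
move=> k0; exists (An F p 1 : vectType F), (dens 0); split; first exact: dens_verma_pred1.
exists (linfun (wlift k)); split; last by split; first exact: wlift_lker0.
by have := @wcopy_intertw k; rewrite /weight (negbTE k0).
Qed.

Lemma wcopy_L k : (2 < p)%N -> k.1 = ord0 -> sub_iso_L (p - 2) (wcopy k).
Proof.
move=> p3 k0; exists (An F p 1 : vectType F), (dens (-1)); split; first exact: is_L_pred2.
exists (linfun (wlift k)); split; last by split; first exact: wlift_lker0.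
by have := @wcopy_intertw k; rewrite /weight k0 eqxx.
Qed.

(** The copies of [V(p-1)], one for each [j] other than the first and each monomial, are numbered
    before the copies of [L(p-2)]. *)
Lemma copy_enum : exists (e : 'I_(m * p ^ m + p ^ m) -> K) (r : K -> 'I_(m * p ^ m + p ^ m)),
  [/\ cancel e r, cancel r e & forall k, (val (r k) < m * p ^ m)%N = (k.1 != ord0)].
Proof.
have c1 : (m * p ^ m)%N = #|{: 'I_m * mono p m}|.
  by rewrite card_prod card_ffun !card_ord.
have c2 : (p ^ m)%N = #|{: mono p m}| by rewrite card_ffun !card_ord.
pose e (i : 'I_(m * p ^ m + p ^ m)) : K := match split i with
  | inl i => let q := enum_val (cast_ord c1 i) in (lift ord0 q.1, q.2)
  | inr i => (ord0, enum_val (cast_ord c2 i)) end.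
pose r (k : K) : 'I_(m * p ^ m + p ^ m) := match unlift ord0 k.1 with
  | Some j => lshift _ (cast_ord (esym c1) (enum_rank (j, k.2)))
  | None => rshift _ (cast_ord (esym c2) (enum_rank k.2)) end.
exists e, r; split.
- move=> i; rewrite /e -[RHS]splitK; case: (split i) => j /=; rewrite /r /=.
    by rewrite liftK -surjective_pairing enum_valK cast_ordK.
  by rewrite unlift_none enum_valK cast_ordK.
- case=> j c; rewrite /r /=; case: unliftP => [j'|] -> /=; rewrite /e.
    by rewrite (unsplitK (inl _)) /= cast_ordKV enum_rankK.
  by rewrite (unsplitK (inr _)) /= cast_ordKV enum_rankK.
case=> j c; rewrite /r /=; case: unliftP => [j'|] -> /=.
  by rewrite (ltn_ord (cast_ord (esym c1) _)).
by rewrite ltnNge leq_addr.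
Qed.

(** * The filtration giving the composition factors *)

Section Filtration.
Variable r : K -> 'I_(m * p ^ m + p ^ m).

(* The constants of all copies of [V(p-1)] come first, then the quotients of these copies by
   their constants, then the copies of [L(p-2)]. *)
Definition level k (a : mono p 1) : nat :=
  if (k.1 != ord0) && (val (a ord0) == 0%N) then val (r k) else (m * p ^ m + r k)%N.

Definition below i k (f : An F p 1) : Prop := forall a, (i <= level k a)%N -> f a = 0.

(** Keeping the coefficients that must vanish makes each filtration term the kernel of a linear
    map. *)
Definition cut i D : {ffun K -> An F p 1} :=
  [ffun k => [ffun a => if (i <= level k a)%N then wslice k D a else 0]].

Fact cut_linear i : linear (cut i).
Proof.
move=> c D E; apply/ffunP=> k; apply/ffunP=> a; rewrite !ffunE.
by case: ifP => _; rewrite ?linearP ?ffunE // scaler0 addr0.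
Qed.
HB.instance Definition _ i := GRing.isLinear.Build _ _ _ _ (cut i) (cut_linear i).

Definition wfilt i : {vspace W} := lker (linfun (cut i)).

Lemma wfiltP i D : reflect (forall k, below i k (wslice k D)) (D \in wfilt i).
Proof.
rewrite memv_ker lfunE; apply: (iffP eqP) => [D0 k a ia | D0].
  by move/ffunP/(_ k)/ffunP/(_ a): D0; rewrite !ffunE ia.
by apply/ffunP=> k; apply/ffunP=> a; rewrite !ffunE; case: ifP => // /D0; rewrite ffunE.
Qed.

(** In each slice the condition allows nothing, everything or, in weight [0] only, the constants;
    each of these is a submodule. *)
Lemma wfilt_stable i : stable (wfilt i).
Proof.
move=> x D /wfiltP Di; apply/wfiltP => k a ia; rewrite wslice_wnact.
(* Constants have the lowest level of their slice: if they are excluded, the whole slice is zero. *)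
have [kle|klt] := leqP i (level k [ffun _ => Ordinal p_gt0]).
  have -> : wslice k D = 0; last by rewrite linear0 ffunE.
  apply/ffunP=> b; rewrite Di ?ffunE //; apply: leq_trans kle _.
  rewrite /level ffunE eqxx andbT; case: ifP => //=; case: ifP => // *; exact: leq_addl.
have k0 : k.1 != ord0.
  by apply: contraLR klt => /negbNE k0; rewrite /level k0 /= -leqNgt in ia *.
rewrite /weight (negbTE k0) dens0_const ?ffunE // => b b0; apply: Di.
apply: leq_trans ia _; rewrite /level k0 (negbTE b0) /=.
by case: ifP => // _; apply: leq_addl.
Qed.

(** Only the slice [k] has coefficients of level [i], so the factor is that of the two conditions on
    this slice, and [phi] needs to be equivariant only on the larger one. *)
Lemma factor_filt lam i k (N : vectType F) (act : Wn F p 1 -> N -> N)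
    (phi : 'Hom(An F p 1, N)) :
  is_L lam act ->
  (forall x u, below i.+1 k u -> phi (dens (weight k) x u) = act x (phi u)) ->
  (forall w, exists2 u, below i.+1 k u & phi u = w) ->
  (forall u, below i.+1 k u -> (phi u = 0 <-> below i k u)) ->
  (forall k' a, level k' a = i -> k' = k) ->
  factor_L lam (wfilt i) (wfilt i.+1).
Proof.
move=> Lact phi_act phi_surj phi0 kP; exists N, act; split=> //.
exists (phi \o linfun (wslice k))%VF; split; [|split].
- move=> x D /wfiltP Di; rewrite !comp_lfunE !lfunE /= wslice_wnact.
  exact: phi_act.
- apply/vspaceP => w; rewrite memvf; have [u ui <-] := phi_surj w.
  apply/memv_imgP; exists (wlift k u); last by rewrite comp_lfunE lfunE /= wslice_liftK.
  apply/wfiltP => k' a; rewrite wslice_lift.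
  by case: eqP => [->|_ _]; [apply: ui | rewrite ffunE].
apply/vspaceP => D; rewrite memv_cap memv_ker comp_lfunE lfunE /=.
apply/andP/wfiltP => [[/eqP D0 /wfiltP Di] k' a | Di].
  rewrite leq_eqVlt => /orP[/eqP lev|]; last exact: Di.
  have kk := kP _ _ (esym lev); subst k'.
  by apply: (phi0 _ (Di k)).1 => //; rewrite lev.
have Di1 : D \in wfilt i.+1 by apply/wfiltP => k' a ia; apply: Di; apply: ltnW.
by split=> //; apply/eqP/(phi0 _ _).2 => //; apply/wfiltP.
Qed.

End Filtration.

End Decomposition.

(** * The decomposition and the composition series *)

Lemma wn_decomposition (F : fieldType) (p m : nat) :
  p \in [pchar F] -> (2 < p)%N ->
  exists Us : 'I_(m * p ^ m + p ^ m) -> {vspace Wn F p m.+1},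
     [/\ directv (\sum_k Us k),
         (\sum_k Us k)%VS = fullv,
         forall k, stable (Us k) &
         forall k, if (val k < m * p ^ m)%N
                   then sub_iso_verma (p - 1) (Us k)
                   else sub_iso_L (p - 2) (Us k)].
Proof.
move=> pcharF p3; have [e [r [eK rK r_lt]]] := copy_enum p m.
exists (fun k => wcopy F (e k)); split.
- apply/directv_sum_independent => us usU us0 k _; rewrite (wcopyP (usU k isT)).
  have -> : wslice (e k) (us k) = 0; last by rewrite linear0.
  move/(congr1 (wslice (e k))): us0; rewrite linear0 raddf_sum.
  rewrite (bigD1 k) //= big1 ?addr0 // => k' kk'.
  by rewrite (wcopyP (usU k' isT)) wslice_lift (can_eq eK) eq_sym (negbTE kk').
- apply/vspaceP => D; rewrite memvf (wlift_sum D).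
  apply: rpred_sum => k _; rewrite -(rK k); apply: subvP (mem_wcopy _ _).
  exact: (sumv_sup (r k)).
- by move=> k; apply: wcopy_stable.
move=> k; rewrite -{1}(eK k) r_lt; case: ifP => [|/negbFE/eqP] k0.
  exact: wcopy_verma.
exact: wcopy_L.
Qed.

Lemma count_iota_const (P : pred nat) (b : bool) (s l : nat) :
  (forall i, (s <= i < s + l)%N -> P i = b) -> count P (iota s l) = (b * l)%N.
Proof.
move=> Pb; rewrite (eq_in_count (a2 := fun=> b)); last first.
  by move=> i; rewrite mem_iota; apply: Pb.
by case: b {Pb}; rewrite ?count_predT ?count_pred0 ?size_iota ?mul1n.
Qed.

Lemma wn_composition_series (F : fieldType) (p m : nat) :
  p \in [pchar F] -> (2 < p)%N ->
  exists (M : nat -> {vspace Wn F p m.+1}) (lam : nat -> nat),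
     let s := (m * p ^ m)%N in
     let q := (p ^ m)%N in
     let k := (s + s + q)%N in
     [/\ M 0%N = 0%VS, M k = fullv,
         forall i, stable (M i),
         forall i, (i < k)%N -> (M i <= M i.+1)%VS /\ factor_L (lam i) (M i) (M i.+1) &
         [/\ count (fun i => lam i == 0%N) (iota 0 k) = s,
             count (fun i => lam i == (p - 1)%N) (iota 0 k) = s &
             count (fun i => lam i == (p - 2)%N) (iota 0 k) = q]].
Proof.
move=> pcharF p3; have p_gt0 := prime_gt0 (pcharf_prime pcharF).
have [e [r [eK rK r_lt]]] := copy_enum p m; have r_inj := can_inj rK.
set s := (m * p ^ m)%N; set q := (p ^ m)%N.
pose lam i := if (i < s)%N then 0%N else if (i < s + s)%N then (p - 1)%N else (p - 2)%N.
have lam1 i : (i < s)%N -> lam i = 0%N by rewrite /lam => ->.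
have lam2 i : (s <= i < s + s)%N -> lam i = (p - 1)%N.
  by rewrite /lam => /andP[si ->]; rewrite ltnNge si.
have lam3 i : (s + s <= i)%N -> lam i = (p - 2)%N.
  by move=> ssi; rewrite /lam !ltnNge ssi (leq_trans (leq_addr _ _) ssi).
have counts b : count (fun i => lam i == b) (iota 0 (s + s + q)) =
    ((0%N == b) * s + (p - 1 == b)%N * s + (p - 2 == b)%N * q)%N.
  rewrite !iotaD !count_cat !add0n.
  by congr (_ + _ + _)%N; apply: count_iota_const => i;
    [move=> /lam1 | move=> /lam2 | case/andP=> /lam3 + _] => ->.
exists (wfilt F r), lam; split.
- apply/vspaceP => D; rewrite memv0; apply/wfiltP/eqP => [D0|-> k a _]; last first.
    by rewrite linear0 ffunE.
  by apply: wsliceP => k; rewrite linear0; apply/ffunP=> a; rewrite D0 ?ffunE.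
- apply/vspaceP => D; rewrite memvf; apply/wfiltP => k a; rewrite leqNgt.
  have rk := ltn_ord (r k); rewrite /level; case: ifP => _.
    by rewrite -addnA (leq_trans rk) // leq_addl.
  by rewrite -addnA ltn_add2l rk.
- by move=> i; apply: wfilt_stable.
- move=> i ik; split.
    by apply/subvP => D /wfiltP Di; apply/wfiltP => k a ia; apply: Di; apply: ltnW.
  have [is1|si] := ltnP i s.
    rewrite lam1 //; have iN : (i < s + q)%N by rewrite (leq_trans is1) ?leq_addr.
    pose k := e (Ordinal iN); have rk : r k = Ordinal iN by rewrite eK.
    have k0 : k.1 != ord0 by rewrite -r_lt rk.
    (* As [i.+1 <= s], every nonconstant coefficient is still required to vanish, so the slice
       consists of constants. *)
    have bP u : below r i.+1 k u -> forall a : mono p 1, val (a ord0) != 0%N -> u a = 0.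
      move=> bu a a0; apply: bu; rewrite /level k0 (negbTE a0) /=.
      by rewrite (leq_trans is1) ?leq_addr.
    pose a0 : mono p 1 := [ffun _ => Ordinal p_gt0].
    have [|phi phiE] := @hom_of_linear F (An F p 1) F^o (fun u => u a0).
      by move=> c u v; rewrite !ffunE.
    apply: (factor_filt (k := k) (act := @triv_act F p) (phi := phi)).
    + exact: is_L0.
    + move=> x u /bP bu; rewrite phiE /weight (negbTE k0) dens0_const ?ffunE //.
    + move=> w; exists (w *: tpoly p 1).
        move=> a; rewrite /level k0; case: eqP => [_|/eqP a1 _] /=; first by rewrite rk ltnn.
        by rewrite !ffunE coef1 (negbTE a1) scaler0.
      rewrite phiE !ffunE coef1 /=; exact: mulr1.
    + move=> u bu; rewrite phiE; split=> [u0 a _|]; last by apply; rewrite /level k0 ffunE /= rk.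
      have [a1|] := eqVneq (val (a ord0)) 0%N; last exact: bP.
      by rewrite -u0; congr (u _); apply: mono1P; rewrite ffunE; apply: val_inj.
    move=> k' a; rewrite /level; case: ifP => _ li.
      by apply: r_inj; apply: val_inj; rewrite rk.
    by move: is1; rewrite -li ltnNge leq_addr.
  (* From level [s] on, the level is [s] plus the number of the copy, so step [i] concerns the copy
     numbered [i - s]. *)
  have iN : (i - s < s + q)%N by rewrite ltn_subLR // addnA.
  pose k := e (Ordinal iN); have rk : r k = Ordinal iN by rewrite eK.
  have sri : (s + r k)%N = i by rewrite rk /= subnKC.
  have bS u : below r i.+1 k u.
    move=> a; rewrite ltnNge /level; case: ifP => _; last by rewrite sri leqnn.
    by rewrite -sri leq_addl.
  have kP k' a : level r k' a = i -> k' = k.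
    rewrite /level; case: ifP => [/andP[k'0 _] ri|_ si'].
      by have := r_lt k'; rewrite k'0 ri ltnNge si.
    by apply: r_inj; apply: val_inj; apply: (@addnI s); rewrite si' sri.
  have [is2|s2i] := ltnP i (s + s).
    rewrite lam2 ?si //.
    have k0 : k.1 != ord0 by rewrite -r_lt rk /= ltn_subLR.
    apply: (factor_filt (k := k) (act := @exact_act F p) (phi := dquo F p)).
    + exact: is_L_pred1.
    + by move=> x u _; rewrite /weight (negbTE k0) dquo_intertw.
    + by move=> w; have [u uw] := dquo_surj w; exists u.
    + move=> u _; split=> [/(dquo_eq0 pcharF) u0 a ia|bu].
        apply: u0; apply: contraTneq ia => a0.
        (* The constants of this copy were added earlier, at level [r k < s + r k]; here [s > 0]
           because [r k < s]. *)
        rewrite /level k0 a0 eqxx /= -ltnNge -sri -[X in (X < _)%N]add0n ltn_add2r.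
        by apply: leq_ltn_trans (leq0n _) (_ : r k < s)%N; rewrite r_lt.
      apply/(dquo_eq0 pcharF) => a a0; apply: bu.
      by rewrite /level (negbTE a0) andbF sri.
    exact: kP.
  rewrite lam3 //.
  have k0 : k.1 = ord0.
    by apply/eqP/negbFE; rewrite -r_lt rk /= ltn_subLR // ltnNge s2i.
  apply: (factor_filt (k := k) (act := dens (-1)) (phi := \1%VF)).
  + exact: is_L_pred2.
  + by move=> x u _; rewrite !id_lfunE /weight k0 eqxx.
  + by move=> w; exists w; rewrite ?id_lfunE.
  + move=> u _; rewrite id_lfunE; split=> [-> a _|bu]; first by rewrite ffunE.
    by apply/ffunP=> a; rewrite bu ?ffunE // /level k0 eqxx /= sri.
  exact: kP.
(* The three labels are pairwise distinct because [p > 2], so each count sees a single block. *)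
have p12 : (p - 1 == p - 2)%N = false.
  by apply/negbTE; rewrite neq_ltn; apply/orP; right; rewrite ltn_sub2l // ltnW.
have p10 : (p - 1 == 0)%N = false by rewrite subn_eq0 leqNgt ltnW.
have p20 : (p - 2 == 0)%N = false by rewrite subn_eq0 leqNgt p3.
rewrite !counts !eqxx p12 p10 p20 [(0 == p - 1)%N]eq_sym [(0 == p - 2)%N]eq_sym p10 p20.
by rewrite [(p - 2 == _)%N]eq_sym p12 !mul0n !mul1n !addn0 !add0n.
Qed.

Theorem theorem3p1 (F : closedFieldType) (p n : nat) :
  prime p -> p \in [pchar F] -> (2 < p)%N -> (1 <= n)%N ->
  (* W(n) = V(p-1)^((n-1)p^(n-1)) (+) L(p-2)^(p^(n-1)) as W(1)-modules *)
  (exists Us : 'I_((n - 1) * p ^ (n - 1) + p ^ (n - 1)) -> {vspace Wn F p n},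
     [/\ directv (\sum_k Us k),
         (\sum_k Us k)%VS = fullv,
         forall k, stable (Us k) &
         forall k, if (val k < (n - 1) * p ^ (n - 1))%N
                   then sub_iso_verma (p - 1) (Us k)
                   else sub_iso_L (p - 2) (Us k)])
  /\
  (* [W(n)] = (n-1)p^(n-1)([L(0)] + [L(p-1)]) + p^(n-1)[L(p-2)] *)
  (exists (M : nat -> {vspace Wn F p n}) (lam : nat -> nat),
     let m := ((n - 1) * p ^ (n - 1))%N in
     let q := (p ^ (n - 1))%N in
     let k := (m + m + q)%N in
     [/\ M 0%N = 0%VS, M k = fullv,
         forall i, stable (M i),
         forall i, (i < k)%N -> (M i <= M i.+1)%VS /\ factor_L (lam i) (M i) (M i.+1) &
         [/\ count (fun i => lam i == 0%N) (iota 0 k) = m,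
             count (fun i => lam i == (p - 1)%N) (iota 0 k) = m &
             count (fun i => lam i == (p - 2)%N) (iota 0 k) = q]]).
Proof.
move=> _ pcharF p3; case: n => // m _; rewrite subSS subn0.
by split; [apply: wn_decomposition | apply: wn_composition_series].
Qed.
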